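(* Let $(T,f,g)$ be a Lie-Yamaguti algebra over a field $k$ of characteristic zero. If $H^2(T,T)\times H^3(T,T)=0$, then $T$ is analytically rigid, i.e. every deformation $(f_t,g_t)$ of $(T,f,g)$ is equivalent to the null deformation $(f_0,g_0)=(f,g)$.
   Context: **Lie-Yamaguti algebra (LYA).** Let $k$ be a field of characteristic zero. A Lie-Yamaguti algebra $(T,f,g)$ is a $k$-vector space $T$ with a bilinear map $f(a,b)=ab$ and a trilinear map $g(a,b,c)=[a,b,c]$ such that for all $a,b,c,d,e\in T$: (1) $aa=0$; (2) $[a,a,b]=0$; (3) $[a,b,c]+[b,c,a]+[c,a,b]+(ab)c+(bc)a+(ca)b=0$; (4) $[ab,c,d]+[bc,a,d]+[ca,b,d]=0$; (5) $[a,b,cd]=[a,b,c]d+c[a,b,d]$; (6) $[a,b,[c,d,e]]=[[a,b,c],d,e]+[c,[a,b,d],e]+[c,d,[a,b,e]]$. **Deformations.** A deformation of $(T,f,g)$ is a pair of formal power series $f_t=\sum_{i\ge 0}t^iF_i$, $g_t=\sum_{i\ge 0}t^iG_i$ with $F_i:T\times T\to T$ $k$-bilinear, $G_i:T\times T\times T\to T$ $k$-trilinear, $F_0=f$, $G_0=g$, such that, with all maps extended multilinearly over $k[[t]]$, identities (1)–(6) hold with $f_t(a,b)$ in place of $ab$ and $g_t(a,b,c)$ in place of $[a,b,c]$, as identities of formal power series in $t$ with coefficients in $T$, for all $a,b,c,d,e\in T$. The null deformation $(f_0,g_0)$ is the one with $F_i=0$, $G_i=0$ for all $i\ge 1$.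 The deformation $(f'_t,g'_t)$ is equivalent to $(f_t,g_t)$ if there is $\Phi_t=1_T+t\varphi_1+t^2\varphi_2+\cdots$, with all $\varphi_i:T\to T$ $k$-linear (extended $k[[t]]$-linearly), such that $f'_t(a,b)=\Phi_t^{-1}f_t(\Phi_t(a),\Phi_t(b))$ and $g'_t(a,b,c)=\Phi_t^{-1}g_t(\Phi_t(a),\Phi_t(b),\Phi_t(c))$ for all $a,b,c\in T$. **Cohomology (coefficients in the regular representation).** Put $\rho(a)b=ab$, $D(a,b)c=[a,b,c]$, $\theta(a,b)c=[c,a,b]$. $C^1(T,T)$ is the space of linear maps $T\to T$. $C^2(T,T)$ is the space of bilinear maps $F:T\times T\to T$ with $F(a,a)=0$, and $C^3(T,T)$ is the space of trilinear maps $G:T\times T\times T\to T$ with $G(a,a,b)=0$. For $\varphi\in C^1(T,T)$, $\delta(\varphi,\varphi)=(\delta_{\rm I}\varphi,\delta_{\rm II}\varphi)\in C^2(T,T)\times C^3(T,T)$, where $(\delta_{\rm I}\varphi)(a,b)=\rho(a)\varphi(b)-\rho(b)\varphi(a)-\varphi(ab)$, $(\delta_{\rm II}\varphi)(a,b,c)=\theta(b,c)\varphi(a)-\theta(a,c)\varphi(b)+D(a,b)\varphi(c)-\varphi([a,b,c])$. For $(F,G)\in C^2(T,T)\times C^3(T,T)$, $\delta(F,G)=(\delta_{\rm I}F,\delta_{\rm II}G)$ and $\delta^*(F,G)=(\delta^*_{\rm I}F,\delta^*_{\rm II}G)$, where (each component may depend on both $F$ and $G$) $(\delta_{\rm I}F)(x_1,x_2,x_3,x_4)=-[\rho(x_3)G(x_1,x_2,x_4)-\rho(x_4)G(x_1,x_2,x_3)-G(x_1,x_2,x_3x_4)]+D(x_1,x_2)F(x_3,x_4)-F([x_1,x_2,x_3],x_4)-F(x_3,[x_1,x_2,x_4])$,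 $(\delta_{\rm II}G)(x_1,\dots,x_5)=-[\theta(x_4,x_5)G(x_1,x_2,x_3)-\theta(x_3,x_5)G(x_1,x_2,x_4)]+D(x_1,x_2)G(x_3,x_4,x_5)-D(x_3,x_4)G(x_1,x_2,x_5)-G([x_1,x_2,x_3],x_4,x_5)-G(x_3,[x_1,x_2,x_4],x_5)-G(x_3,x_4,[x_1,x_2,x_5])+G(x_1,x_2,[x_3,x_4,x_5])$, $(\delta^*_{\rm I}F)(a,b,c)=-\rho(a)F(b,c)-\rho(b)F(c,a)-\rho(c)F(a,b)+F(ab,c)+F(bc,a)+F(ca,b)+G(a,b,c)+G(b,c,a)+G(c,a,b)$, $(\delta^*_{\rm II}G)(a,b,c,d)=\theta(a,d)F(b,c)+\theta(b,d)F(c,a)+\theta(c,d)F(a,b)+G(ab,c,d)+G(bc,a,d)+G(ca,b,d)$. $Z^2(T,T)\times Z^3(T,T)$ denotes the space of pairs $(F,G)\in C^2(T,T)\times C^3(T,T)$ with $\delta(F,G)=0$ and $\delta^*(F,G)=0$; $B^2(T,T)\times B^3(T,T)=\{\delta(\varphi,\varphi):\varphi\in C^1(T,T)\}$; and $H^2(T,T)\times H^3(T,T)$ is the quotient $(Z^2(T,T)\times Z^3(T,T))/(B^2(T,T)\times B^3(T,T))$. *)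

(* Defs.v *)
From mathcomp Require Import all_boot all_order all_algebra.

Set Implicit Arguments.
Unset Strict Implicit.
Unset Printing Implicit Defensive.

Import GRing.Theory.
Local Open Scope ring_scope.

Section LieYamaguti.

Variables (k : fieldType) (T : lmodType k).

Definition is_bilinear (F : T -> T -> T) : Prop := bilinear_for *:%R *:%R F.

Definition is_trilinear (G : T -> T -> T -> T) : Prop :=
  [/\ forall b c, linear (fun a => G a b c),
      forall a c, linear (fun b => G a b c) &
      forall a b, linear (fun c => G a b c)].

Record is_LYA (f : T -> T -> T) (g : T -> T -> T -> T) : Prop := IsLYA {
  LYA_bilinear : is_bilinear f;
  LYA_trilinear : is_trilinear g;
  LYA1 : forall a, f a a = 0;
  LYA2 : forall a b, g a a b = 0;
  LYA3 : forall a b c,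
    g a b c + g b c a + g c a b + f (f a b) c + f (f b c) a + f (f c a) b = 0;
  LYA4 : forall a b c d,
    g (f a b) c d + g (f b c) a d + g (f c a) b d = 0;
  LYA5 : forall a b c d, g a b (f c d) = f (g a b c) d + f c (g a b d);
  LYA6 : forall a b c d e,
    g a b (g c d e) = g (g a b c) d e + g c (g a b d) e + g c d (g a b e)
}.

(* The formal power series \sum_n t^n u_n with coefficients in T is encoded by
   its coefficient function u; equality of series is =1, and \+ and \0 are the
   (pointwise) sum and zero of series. *)
Definition series := nat -> T.

Definition cst (a : T) : series := fun n => if n == 0%N then a else 0.

(* k[[t]]-multilinear extensions to series of \sum_i t^i Phi_i, \sum_i t^i F_i
   and \sum_i t^i G_i: the coefficient of t^n collects all the contributions of
   total degree n. *)
Definition ext1 (Phi : nat -> T -> T) (u : series) : series := fun n =>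
  \sum_(i < n.+1) \sum_(p < n.+1 | (i + p == n)%N) Phi i (u p).

Definition ext2 (F : nat -> T -> T -> T) (u v : series) : series := fun n =>
  \sum_(i < n.+1) \sum_(p < n.+1) \sum_(q < n.+1 | (i + p + q == n)%N)
    F i (u p) (v q).

Definition ext3 (G : nat -> T -> T -> T -> T) (u v w : series) : series :=
  fun n =>
  \sum_(i < n.+1) \sum_(p < n.+1) \sum_(q < n.+1)
    \sum_(r < n.+1 | (i + p + q + r == n)%N) G i (u p) (v q) (w r).

Record is_deformation (f : T -> T -> T) (g : T -> T -> T -> T)
    (F : nat -> T -> T -> T) (G : nat -> T -> T -> T -> T) : Prop :=
  IsDeformation {
  def_bilinear : forall i, is_bilinear (F i);
  def_trilinear : forall i, is_trilinear (G i);
  def_F0 : forall a b, F 0%N a b = f a b;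
  def_G0 : forall a b c, G 0%N a b c = g a b c;
  def1 : forall a, let ft := ext2 F in
    ft (cst a) (cst a) =1 \0;
  def2 : forall a b, let gt := ext3 G in
    gt (cst a) (cst a) (cst b) =1 \0;
  def3 : forall a b c, let ft := ext2 F in let gt := ext3 G in
    gt (cst a) (cst b) (cst c) \+ gt (cst b) (cst c) (cst a)
      \+ gt (cst c) (cst a) (cst b)
      \+ ft (ft (cst a) (cst b)) (cst c) \+ ft (ft (cst b) (cst c)) (cst a)
      \+ ft (ft (cst c) (cst a)) (cst b) =1 \0;
  def4 : forall a b c d, let ft := ext2 F in let gt := ext3 G in
    gt (ft (cst a) (cst b)) (cst c) (cst d)
      \+ gt (ft (cst b) (cst c)) (cst a) (cst d)
      \+ gt (ft (cst c) (cst a)) (cst b) (cst d) =1 \0;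
  def5 : forall a b c d, let ft := ext2 F in let gt := ext3 G in
    gt (cst a) (cst b) (ft (cst c) (cst d)) =1
      ft (gt (cst a) (cst b) (cst c)) (cst d)
      \+ ft (cst c) (gt (cst a) (cst b) (cst d));
  def6 : forall a b c d e, let gt := ext3 G in
    gt (cst a) (cst b) (gt (cst c) (cst d) (cst e)) =1
      gt (gt (cst a) (cst b) (cst c)) (cst d) (cst e)
      \+ gt (cst c) (gt (cst a) (cst b) (cst d)) (cst e)
      \+ gt (cst c) (cst d) (gt (cst a) (cst b) (cst e))
}.

Definition null2 (f : T -> T -> T) : nat -> T -> T -> T :=
  fun i a b => if i == 0%N then f a b else 0.

Definition null3 (g : T -> T -> T -> T) : nat -> T -> T -> T -> T :=
  fun i a b c => if i == 0%N then g a b c else 0.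

Definition is_formal_iso (Phi : nat -> T -> T) : Prop :=
  (forall a, Phi 0%N a = a) /\ (forall i, linear (Phi i)).

Definition is_formal_inverse (Phi Psi : nat -> T -> T) : Prop :=
  [/\ forall i, linear (Psi i),
      forall u : series, ext1 Psi (ext1 Phi u) =1 u &
      forall u : series, ext1 Phi (ext1 Psi u) =1 u].

(* Psi is the series Phi_t^-1, which exists and is unique since Phi_0 = 1. *)
Definition equivalent_deformations
    (F' : nat -> T -> T -> T) (G' : nat -> T -> T -> T -> T)
    (F : nat -> T -> T -> T) (G : nat -> T -> T -> T -> T) : Prop :=
  exists Phi Psi : nat -> T -> T,
    [/\ is_formal_iso Phi,
        is_formal_inverse Phi Psi,
        forall a b,
          ext2 F' (cst a) (cst b) =1
          ext1 Psi (ext2 F (ext1 Phi (cst a)) (ext1 Phi (cst b))) &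
        forall a b c,
          ext3 G' (cst a) (cst b) (cst c) =1
          ext1 Psi (ext3 G (ext1 Phi (cst a)) (ext1 Phi (cst b))
                           (ext1 Phi (cst c)))].

Definition analytically_rigid (f : T -> T -> T) (g : T -> T -> T -> T) : Prop :=
  forall F G, is_deformation f g F G ->
    equivalent_deformations F G (null2 f) (null3 g).

Section Cohomology.

Variables (f : T -> T -> T) (g : T -> T -> T -> T).

Definition rho (a b : T) : T := f a b.
Definition D (a b c : T) : T := g a b c.
Definition theta (a b c : T) : T := g c a b.

Definition C1 (phi : T -> T) : Prop := linear phi.

Definition C2 (F : T -> T -> T) : Prop :=
  is_bilinear F /\ forall a, F a a = 0.

Definition C3 (G : T -> T -> T -> T) : Prop :=
  is_trilinear G /\ forall a b, G a a b = 0.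

Definition delta1_I (phi : T -> T) (a b : T) : T :=
  rho a (phi b) - rho b (phi a) - phi (f a b).

Definition delta1_II (phi : T -> T) (a b c : T) : T :=
  theta b c (phi a) - theta a c (phi b) + D a b (phi c) - phi (g a b c).

Definition delta_I (F : T -> T -> T) (G : T -> T -> T -> T)
    (x1 x2 x3 x4 : T) : T :=
  - (rho x3 (G x1 x2 x4) - rho x4 (G x1 x2 x3) - G x1 x2 (f x3 x4))
  + D x1 x2 (F x3 x4) - F (g x1 x2 x3) x4 - F x3 (g x1 x2 x4).

Definition delta_II (G : T -> T -> T -> T) (x1 x2 x3 x4 x5 : T) : T :=
  - (theta x4 x5 (G x1 x2 x3) - theta x3 x5 (G x1 x2 x4))
  + D x1 x2 (G x3 x4 x5) - D x3 x4 (G x1 x2 x5)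
  - G (g x1 x2 x3) x4 x5 - G x3 (g x1 x2 x4) x5 - G x3 x4 (g x1 x2 x5)
  + G x1 x2 (g x3 x4 x5).

Definition deltastar_I (F : T -> T -> T) (G : T -> T -> T -> T)
    (a b c : T) : T :=
  - rho a (F b c) - rho b (F c a) - rho c (F a b)
  + F (f a b) c + F (f b c) a + F (f c a) b
  + G a b c + G b c a + G c a b.

Definition deltastar_II (F : T -> T -> T) (G : T -> T -> T -> T)
    (a b c d : T) : T :=
  theta a d (F b c) + theta b d (F c a) + theta c d (F a b)
  + G (f a b) c d + G (f b c) a d + G (f c a) b d.

Record in_Z2Z3 (F : T -> T -> T) (G : T -> T -> T -> T) : Prop := InZ2Z3 {
  Z_C2 : C2 F;
  Z_C3 : C3 G;
  Z_delta_I : forall x1 x2 x3 x4, delta_I F G x1 x2 x3 x4 = 0;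
  Z_delta_II : forall x1 x2 x3 x4 x5, delta_II G x1 x2 x3 x4 x5 = 0;
  Z_deltastar_I : forall a b c, deltastar_I F G a b c = 0;
  Z_deltastar_II : forall a b c d, deltastar_II F G a b c d = 0
}.

Definition in_B2B3 (F : T -> T -> T) (G : T -> T -> T -> T) : Prop :=
  exists phi, [/\ C1 phi,
    forall a b, F a b = delta1_I phi a b &
    forall a b c, G a b c = delta1_II phi a b c].

(* Equality of the classes of (F, G) and (F', G') modulo B^2 x B^3. *)
Definition cohomologous (F : T -> T -> T) (G : T -> T -> T -> T)
    (F' : T -> T -> T) (G' : T -> T -> T -> T) : Prop :=
  in_B2B3 (fun a b => F a b - F' a b) (fun a b c => G a b c - G' a b c).

(* H^2(T,T) x H^3(T,T) = 0: every class of Z^2 x Z^3 modulo B^2 x B^3 is the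
   zero class. *)
Definition H2H3_eq0 : Prop :=
  forall F G, in_Z2Z3 F G ->
    cohomologous F G (fun _ _ => 0) (fun _ _ _ => 0).

End Cohomology.

End LieYamaguti.

(* Main.v *)
Require Import Defs.
From HB Require Import structures.
From mathcomp Require Import all_boot all_order all_algebra.
From mathcomp Require Import zify.
From mathcomp Require Import boolp functions.
(* Restores the constant series cst, shadowed by the constant functions. *)
Import Defs.

(** A deformation (f_t, g_t) is equivalent to the null one as soon as some
    Phi_t = 1 + t phi_1 + ... satisfies
      Phi_t f_t(a, b) = f(Phi_t a, Phi_t b) and
      Phi_t g_t(a, b, c) = g(Phi_t a, Phi_t b, Phi_t c).
    Call the differences of the two sides the defects of Phi_t. Such a Phi_t is
    built one coefficient at a time. Suppose that the defects vanish modulo t^n.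
    Applying Phi_t to the Lie-Yamaguti identities of (f_t, g_t), and comparing
    with those of (f, g) at Phi_t a, Phi_t b, ..., shows that the coefficients
    of t^n in the defects form a pair in Z^2 x Z^3 (defect_cocycle). As
    H^2 x H^3 vanishes, this cocycle is the coboundary of some phi, and adding phi to the
    n-th coefficient of Phi_t subtracts exactly this coboundary from the
    defects, which then vanish modulo t^(n+1) (defect2_change, defect3_change,
    trivializes_step). Dependent choice yields a Phi_t without defect
    (exists_trivializing), and Phi_t is invertible since its constant term is
    the identity (tlinear_unit_inverse).

    Sums over total degrees are manipulated mainly to show that the
    extensions of linear maps to series are linear and commute with
    multiplication by t. Such maps are called t-linear below. A t-linear map is
    determined by its values on constants, and if it vanishes modulo t^n on
    constants, then it does so everywhere, with a coefficient of t^n that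
    depends only on the constant terms of its arguments. Hence the identities
    (1)-(6), assumed for constants, say that the series with coefficients in T
    form a Lie-Yamaguti algebra (deformation_LYA), where the computations with
    cocycles take place. *)

Set Implicit Arguments.
Unset Strict Implicit.
Unset Printing Implicit Defensive.

Import GRing.Theory.
Local Open Scope ring_scope.

(** * Linear maps given by a proof of linearity *)

Section LinearMaps.
Variables (k : fieldType) (U V : lmodType k) (A : U -> V).
Hypothesis linA : linear A.
Let AL : {linear U -> V} := HB.pack A (GRing.isLinear.Build _ _ _ _ A linA).

Lemma linD u v : A (u + v) = A u + A v. Proof. exact: (linearD AL). Qed.
Lemma lin0 : A 0 = 0. Proof. exact: (linear0 AL). Qed.
Lemma linN u : A (- u) = - A u. Proof. exact: (linearN AL). Qed.
Lemma linB u v : A (u - v) = A u - A v. Proof. exact: (linearB AL). Qed.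
End LinearMaps.

(** * Deciding equalities in abelian groups *)

(** Expressions of abelian groups are reified and compared through the integer
    multiplicities of their atoms. *)
Section AbelianGroupNormalization.
Variable V : zmodType.

Inductive gexpr := GZero | GAtom of nat | GAdd of gexpr & gexpr | GOpp of gexpr.

(** The value of an expression, whose atoms are the items of e. *)
Fixpoint geval (e : seq V) t : V :=
  match t with
  | GZero => 0
  | GAtom i => e`_i
  | GAdd t1 t2 => geval e t1 + geval e t2
  | GOpp t1 => - geval e t1
  end.

(** The multiplicity of the i-th atom in an expression. *)
Fixpoint gmult (i : nat) t : int :=
  match t with
  | GZero => 0
  | GAtom j => (i == j)%:Z
  | GAdd t1 t2 => gmult i t1 + gmult i t2
  | GOpp t1 => - gmult i t1
  end.

Lemma gevalE e t : geval e t = \sum_(i < size e) e`_i *~ gmult i t.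
Proof.
elim: t => [|j|t1 IH1 t2 IH2|t1 IH1] /=.
- by rewrite big1 // => i _; rewrite mulr0z.
- case: (ltnP j (size e)) => Hj.
    rewrite (bigD1 (Ordinal Hj)) //= eqxx mulr1z big1 ?addr0 // => i.
    by rewrite -val_eqE /= => /negbTE ->; rewrite mulr0z.
  rewrite nth_default // big1 // => i _.
  by rewrite (ltn_eqF (leq_trans (ltn_ord i) Hj)) mulr0z.
- by rewrite IH1 IH2 -big_split; apply: eq_bigr => i _; rewrite mulrzDr.
- by rewrite IH1 -sumrN; apply: eq_bigr => i _; rewrite mulrNz.
Qed.

Lemma geval_eq e t s :
  all (fun i => gmult i t == gmult i s) (iota 0 (size e)) ->
  geval e t = geval e s.
Proof.
move=> /allP H; rewrite !gevalE; apply: eq_bigr => i _.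
by rewrite (eqP (H (i : nat) _)) // mem_iota ltn_ord.
Qed.

(** Proves x = y from l = r when x - y and l - r are the same combination. *)
Lemma eq_by_diff (x y l r : V) : l = r -> x - y = l - r -> x = y.
Proof. by move=> ->; rewrite subrr => /eqP; rewrite subr_eq0 => /eqP. Qed.
End AbelianGroupNormalization.

Ltac atom_index x e :=
  lazymatch e with
  | x :: _ => constr:(0%N)
  | _ :: ?e' => let n := atom_index x e' in constr:(S n)
  end.

Ltac add_atom x e :=
  match e with
  | _ => let _ := atom_index x e in e
  | _ => constr:(x :: e)
  end.

Ltac atoms t e :=
  lazymatch t with
  | @GRing.add _ ?a ?b => let e := atoms a e in atoms b e
  | @GRing.opp _ ?a => atoms a e
  | @GRing.zero _ => e
  | _ => add_atom t e
  end.

Ltac reify t e :=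
  lazymatch t with
  | @GRing.add _ ?a ?b =>
      let a := reify a e in let b := reify b e in constr:(GAdd a b)
  | @GRing.opp _ ?a => let a := reify a e in constr:(GOpp a)
  | @GRing.zero _ => constr:(GZero)
  | _ => let n := atom_index t e in constr:(GAtom n)
  end.

(** Proves equalities that hold in every abelian group. *)
Ltac abelian :=
  lazymatch goal with |- @eq ?V ?l ?r =>
    let e := atoms l (@nil V) in let e := atoms r e in
    let t := reify l e in let s := reify r e in
    apply: (@geval_eq _ e t s); vm_compute; reflexivity
  end.

(** * t-linear maps on formal power series *)

Section Series.
Variables (k : fieldType) (T : lmodType k).

Local Notation ser := (nat -> T).
Implicit Types (u v w : ser) (A : ser -> ser).

(** Multiplication by t. *)
Definition shift u : ser := fun n => if n is m.+1 then u m else 0.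

Lemma coefD u v n : (u + v) n = u n + v n. Proof. by []. Qed.
Lemma coefN u n : (- u) n = - u n. Proof. by []. Qed.
Lemma coefZ (c : k) u n : (c *: u) n = c *: u n. Proof. by []. Qed.
Lemma coef0 n : (0 : ser) n = 0. Proof. by []. Qed.
Definition coefE := (coefD, coefN, coefZ, coef0).

Lemma series_split u : u = cst (u 0%N) + shift (u \o S).
Proof. by apply/funext => -[|n] /=; rewrite coefD /cst /= ?addr0 ?add0r. Qed.

Lemma cst_linear : linear (@cst k T : T -> ser).
Proof.
by move=> c a b; apply/funext => -[|n]; rewrite !coefE /cst //= scaler0 addr0.
Qed.

Lemma cst0 : cst 0 = 0 :> ser. Proof. exact: lin0 cst_linear. Qed.
Lemma cstD a b : cst (a + b) = cst a + cst b :> ser.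
Proof. exact: linD cst_linear a b. Qed.

Lemma shift_linear : linear shift.
Proof.
by move=> c u v; apply/funext => -[|n] //; rewrite !coefE /= scaler0 addr0.
Qed.

(** k-linear maps that commute with multiplication by t. *)
Definition tlinear A := linear A /\ forall u, A (shift u) = shift (A u).

(** If t^n divides u then t^n divides A u, and the coefficient of t^n in A u is
    the constant term of A (u / t^n). *)
Lemma tlinear_order A n u : tlinear A -> (forall i, (i < n)%N -> u i = 0) ->
  (forall i, (i < n)%N -> A u i = 0) /\ A u n = A (fun m => u (m + n)%N) 0%N.
Proof.
move=> [_ AS]; elim: n u => [|n IHn] u u0.
  by split => //; congr (A _ _); apply/funext => m; rewrite addn0.
have -> : u = shift (u \o S).
  by apply/funext => -[|m] //; rewrite u0.
rewrite AS /=; have [|H1 H2] := IHn (u \o S); first by move=> i ?; apply: u0.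
split; first by case=> // i /H1.
by rewrite H2; congr (A _ _); apply/funext => m /=; rewrite addnS.
Qed.

Lemma tlinear_coef0 A u : tlinear A -> A u 0%N = A (cst (u 0%N)) 0%N.
Proof.
move=> [Alin AS]; rewrite {1}[u]series_split (linD Alin) AS !coefE /=.
by rewrite addr0.
Qed.

Lemma tlinear_vanish A n : tlinear A ->
  (forall a i, (i < n)%N -> A (cst a) i = 0) ->
  forall u i, (i < n)%N -> A u i = 0.
Proof.
move=> [Alin AS] A0 u i; elim: i u => [|i IHi] u lin;
  rewrite [u]series_split (linD Alin) AS !coefE A0 //= add0r //.
by apply: IHi; exact: ltnW.
Qed.

(** As A is divisible by t^n, the part t u' of u = a + t u' only contributes to
    degrees above n. *)
Lemma tlinear_lead A n : tlinear A ->
  (forall a i, (i < n)%N -> A (cst a) i = 0) ->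
  forall u, A u n = A (cst (u 0%N)) n.
Proof.
move=> At A0 u; rewrite {1}[u]series_split (linD At.1) At.2 !coefE.
case: n A0 => [|n] A0 /=; first by rewrite addr0.
by rewrite (tlinear_vanish At A0 (u \o S) (ltnSn n)) addr0.
Qed.

Lemma tlinear_ext A B : tlinear A -> tlinear B ->
  (forall a, A (cst a) = B (cst a)) -> forall u, A u = B u.
Proof.
move=> At Bt AB u; apply/funext => n; elim: n u => [|n IHn] u;
  rewrite [u]series_split (linD At.1) (linD Bt.1) At.2 Bt.2;
  by rewrite !coefE AB /= ?IHn.
Qed.

Lemma tlinear_id : tlinear (fun u => u). Proof. by split. Qed.

Lemma tlinear0 : tlinear (fun=> 0).
Proof.
split; first by move=> c u v; rewrite scaler0 addr0.
by move=> u; rewrite (lin0 shift_linear).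
Qed.

Lemma tlinearD A B : tlinear A -> tlinear B -> tlinear (fun u => A u + B u).
Proof.
move=> [A1 A2] [B1 B2]; split=> [c u v|u].
  by rewrite A1 B1 scalerDr addrACA.
by rewrite A2 B2 (linD shift_linear).
Qed.

Lemma tlinearN A : tlinear A -> tlinear (fun u => - A u).
Proof.
move=> [A1 A2]; split=> [c u v|u]; last by rewrite A2 (linN shift_linear).
by rewrite A1 opprD scalerN.
Qed.

Lemma tlinear_comp A B : tlinear A -> tlinear B -> tlinear (fun u => A (B u)).
Proof.
by move=> [A1 A2] [B1 B2]; split=> [c u v|u]; rewrite ?B1 ?A1 ?B2 ?A2.
Qed.

(** Maps of two arguments that are t-linear in each of them. *)
Definition tbilinear (B : ser -> ser -> ser) :=
  (forall v, tlinear (B^~ v)) /\ forall u, tlinear (B u).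

(** Maps of three arguments that are t-linear in each of them. *)
Definition ttrilinear (C : ser -> ser -> ser -> ser) :=
  [/\ forall v w, tlinear (fun u => C u v w),
      forall u w, tlinear (fun v => C u v w) &
      forall u v, tlinear (C u v)].

Section Compose.
Variables (B : ser -> ser -> ser) (C : ser -> ser -> ser -> ser).
Hypotheses (Bt : tbilinear B) (Ct : ttrilinear C).
Variable A : ser -> ser.
Hypothesis At : tlinear A.

Lemma tbilinear_l v : tlinear (fun u => B (A u) v).
Proof. exact: (tlinear_comp (Bt.1 v) At). Qed.
Lemma tbilinear_r v : tlinear (fun u => B v (A u)).
Proof. exact: (tlinear_comp (Bt.2 v) At). Qed.
Lemma ttrilinear_1 v w : tlinear (fun u => C (A u) v w).
Proof. by case: Ct => h _ _; exact: (tlinear_comp (h v w) At). Qed.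
Lemma ttrilinear_2 v w : tlinear (fun u => C v (A u) w).
Proof. by case: Ct => _ h _; exact: (tlinear_comp (h v w) At). Qed.
Lemma ttrilinear_3 v w : tlinear (fun u => C v w (A u)).
Proof. by case: Ct => _ _ h; exact: (tlinear_comp (h v w) At). Qed.
End Compose.

(** With u = a + t u', antisymmetry reduces B(u, u) to t^2 B(u', u'). *)
Lemma tbilinear_alternate B : tbilinear B ->
  (forall a, B (cst a) (cst a) = 0) -> forall u, B u u = 0.
Proof.
move=> Bt B0.
have Banti u v : B u v + B v u = 0.
  apply: (@tlinear_ext (fun u => B u v + B v u) (fun=> 0)) u => [||a].
  - by apply: tlinearD; [exact: Bt.1|exact: Bt.2].
  - exact: tlinear0.
  apply: (@tlinear_ext (fun v => B (cst a) v + B v (cst a)) (fun=> 0)) v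
    => [||b].
  - by apply: tlinearD; [exact: Bt.2|exact: Bt.1].
  - exact: tlinear0.
  have := B0 (a + b); rewrite cstD (linD (Bt.1 _).1) !(linD (Bt.2 _).1) !B0.
  by rewrite add0r addr0.
move=> u; apply/funext => n.
elim/ltn_ind: n u => n IHn u.
rewrite [u]series_split (linD (Bt.1 _).1) !(linD (Bt.2 _).1) B0 add0r addrA.
rewrite Banti add0r (Bt.1 _).2 (Bt.2 _).2.
by case: n IHn => [|[|n]] IHn //=; rewrite IHn.
Qed.

(** * Extensions of multilinear maps to series *)

Lemma sum_last_eq0 (n : nat) (Y : 'I_n.+1 -> T) :
  Y ord_max = 0 ->
  \sum_(i < n.+1) Y i = \sum_(i < n) Y (widen_ord (leqnSn n) i).
Proof. by move=> Y0; rewrite big_ord_recr /= Y0 addr0. Qed.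

Lemma sum_first_eq0 (n : nat) (Y : 'I_n.+1 -> T) :
  Y ord0 = 0 -> \sum_(i < n.+1) Y i = \sum_(i < n) Y (lift ord0 i).
Proof. by move=> Y0; rewrite big_ord_recl /= Y0 add0r. Qed.

(** Reindexings of sums over a total degree. The second index is shifted; the
    other indices cannot reach n.+1 unless the second one is 0, in which case
    the term vanishes. *)
Lemma sum_shift2 (n : nat) (X : nat -> nat -> T) :
  (forall i, X i 0%N = 0) ->
  \sum_(i < n.+2) \sum_(p < n.+2 | (i + p == n.+1)%N) X i p =
  \sum_(i < n.+1) \sum_(p < n.+1 | (i + p == n)%N) X i p.+1.
Proof.
move=> X0.
have out i p : (p == 0)%N || (n.+1 < i + p)%N -> (i + p == n.+1)%N -> X i p = 0.
  by case/orP => [/eqP -> _|]; [exact: X0|lia].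
rewrite sum_last_eq0 => [|/=]; last first.
  by apply: big1 => -[? ?] /= H; apply: out (H); lia.
apply: eq_bigr => -[i Hi] _.
rewrite big_mkcond sum_first_eq0 => [|/=]; last first.
  by case: ifP => // H; apply: out (H).
rewrite [RHS]big_mkcond; apply: eq_bigr => -[p Hp] _ /=.
by rewrite /bump /= !addnS.
Qed.

Lemma sum_shift3 (n : nat) (X : nat -> nat -> nat -> T) :
  (forall i q, X i 0%N q = 0) ->
  \sum_(i < n.+2) \sum_(p < n.+2)
    \sum_(q < n.+2 | (i + p + q == n.+1)%N) X i p q =
  \sum_(i < n.+1) \sum_(p < n.+1)
    \sum_(q < n.+1 | (i + p + q == n)%N) X i p.+1 q.
Proof.
move=> X0.
have out i p q : (p == 0)%N || (n.+1 < i + p + q)%N ->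
    (i + p + q == n.+1)%N -> X i p q = 0.
  by case/orP => [/eqP -> _|]; [exact: X0|lia].
rewrite sum_last_eq0 => [|/=]; last first.
  apply: big1 => -[? ?] _ /=.
  by apply: big1 => -[? ?] /= H; apply: out (H); lia.
apply: eq_bigr => -[i Hi] _.
rewrite sum_first_eq0 => [|/=]; last first.
  by apply: big1 => -[? ?] /= H; apply: out (H).
apply: eq_bigr => -[p Hp] _.
rewrite big_mkcond sum_last_eq0 => [|/=]; last first.
  by case: ifP => // H; apply: out (H); rewrite /bump /=; lia.
rewrite [RHS]big_mkcond; apply: eq_bigr => -[q Hq] _ /=.
by rewrite /bump /= !addnS !addSn.
Qed.

Lemma sum_shift4 (n : nat) (X : nat -> nat -> nat -> nat -> T) :
  (forall i q r, X i 0%N q r = 0) ->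
  \sum_(i < n.+2) \sum_(p < n.+2) \sum_(q < n.+2)
    \sum_(r < n.+2 | (i + p + q + r == n.+1)%N) X i p q r =
  \sum_(i < n.+1) \sum_(p < n.+1) \sum_(q < n.+1)
    \sum_(r < n.+1 | (i + p + q + r == n)%N) X i p.+1 q r.
Proof.
move=> X0.
have out i p q r : (p == 0)%N || (n.+1 < i + p + q + r)%N ->
    (i + p + q + r == n.+1)%N -> X i p q r = 0.
  by case/orP => [/eqP -> _|]; [exact: X0|lia].
rewrite sum_last_eq0 => [|/=]; last first.
  do 2!(apply: big1 => -[? ?] _ /=).
  by apply: big1 => -[? ?] /= H; apply: out (H); lia.
apply: eq_bigr => -[i Hi] _.
rewrite sum_first_eq0 => [|/=]; last first.
  by apply: big1 => -[? ?] _ /=; apply: big1 => -[? ?] /= H; apply: out (H).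
apply: eq_bigr => -[p Hp] _.
rewrite sum_last_eq0 => [|/=]; last first.
  by apply: big1 => -[? ?] /= H; apply: out (H); rewrite /bump /=; lia.
apply: eq_bigr => -[q Hq] _.
rewrite big_mkcond sum_last_eq0 => [|/=]; last first.
  by case: ifP => // H; apply: out (H); rewrite /bump /=; lia.
rewrite [RHS]big_mkcond; apply: eq_bigr => -[r Hr] _ /=.
by rewrite /bump /= !addnS !addSn.
Qed.

Lemma ext1_tlinear (Phi : nat -> T -> T) :
  (forall i, linear (Phi i)) -> tlinear (ext1 Phi).
Proof.
move=> Plin; split=> [c u v|u]; apply/funext => n.
  rewrite !coefE /ext1 scaler_sumr -big_split /=; apply: eq_bigr => i _.
  by rewrite scaler_sumr -big_split /=; apply: eq_bigr => p _; exact: Plin.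
have P0 i : Phi i 0 = 0 by exact: lin0 (Plin i).
case: n => [|n] /=; rewrite /ext1.
  do 2!(apply: big1 => -[[|?] ?] // _); exact: P0.
apply: (@sum_shift2 n (fun i p => Phi i (shift u p))) => i.
exact: P0.
Qed.

Lemma ext2_swap (F : nat -> T -> T -> T) u v :
  ext2 F u v = ext2 (fun i a b => F i b a) v u.
Proof.
apply/funext => n; rewrite /ext2; apply: eq_bigr => i _.
rewrite (exchange_big_dep xpredT) //=; apply: eq_bigr => p _.
by apply: eq_bigl => q; rewrite addnAC.
Qed.

Lemma ext2_tlinear_l (F : nat -> T -> T -> T) v :
  (forall i b, linear (F i ^~ b)) -> tlinear (ext2 F ^~ v).
Proof.
move=> Flin; split=> [c u u'|u]; apply/funext => n.
  rewrite !coefE /ext2 scaler_sumr -big_split /=; apply: eq_bigr => i _.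
  rewrite scaler_sumr -big_split /=; apply: eq_bigr => p _.
  by rewrite scaler_sumr -big_split /=; apply: eq_bigr => q _; exact: Flin.
have F0 i b : F i 0 b = 0 by exact: lin0 (Flin i b).
case: n => [|n] /=; rewrite /ext2.
  do 3!(apply: big1 => -[[|?] ?] // _); exact: F0.
apply: (@sum_shift3 n (fun i p q => F i (shift u p) (v q))) => i q.
exact: F0.
Qed.

Lemma ext2_tbilinear (F : nat -> T -> T -> T) :
  (forall i, is_bilinear (F i)) -> tbilinear (ext2 F).
Proof.
move=> Flin; split=> [v|u].
  by apply: ext2_tlinear_l => i b; exact: (Flin i).1.
have -> : ext2 F u = fun v => ext2 (fun i a b => F i b a) v u.
  by apply/funext => v; rewrite ext2_swap.
by apply: ext2_tlinear_l => i b; exact: (Flin i).2.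
Qed.

Lemma ext3_swap12 (G : nat -> T -> T -> T -> T) u v w :
  ext3 G u v w = ext3 (fun i a b c => G i b a c) v u w.
Proof.
apply/funext => n; rewrite /ext3; apply: eq_bigr => i _.
rewrite exchange_big /=; do 2!(apply: eq_bigr => ? _).
by apply: eq_bigl => q; rewrite (addnAC i).
Qed.

Lemma ext3_swap23 (G : nat -> T -> T -> T -> T) u v w :
  ext3 G u v w = ext3 (fun i a b c => G i a c b) u w v.
Proof.
apply/funext => n; rewrite /ext3; do 2!(apply: eq_bigr => ? _).
rewrite (exchange_big_dep xpredT) //=; apply: eq_bigr => ? _.
by apply: eq_bigl => q; rewrite addnAC.
Qed.

Lemma ext3_tlinear_1 (G : nat -> T -> T -> T -> T) v w :
  (forall i b c, linear (fun a => G i a b c)) ->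
  tlinear (fun u => ext3 G u v w).
Proof.
move=> Glin; split=> [c u u'|u]; apply/funext => n.
  rewrite !coefE /ext3 scaler_sumr -big_split /=; apply: eq_bigr => i _.
  rewrite scaler_sumr -big_split /=; apply: eq_bigr => p _.
  rewrite scaler_sumr -big_split /=; apply: eq_bigr => q _.
  by rewrite scaler_sumr -big_split /=; apply: eq_bigr => r _; exact: Glin.
have G0 i b c : G i 0 b c = 0 by exact: lin0 (Glin i b c).
case: n => [|n] /=; rewrite /ext3.
  do 4!(apply: big1 => -[[|?] ?] // _); exact: G0.
apply: (@sum_shift4 n (fun i p q r => G i (shift u p) (v q) (w r)))
  => i q r.
exact: G0.
Qed.

Lemma ext3_ttrilinear (G : nat -> T -> T -> T -> T) :
  (forall i, is_trilinear (G i)) -> ttrilinear (ext3 G).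
Proof.
move=> Glin; split=> [v w|u w|u v].
- by apply: ext3_tlinear_1 => i b c; case: (Glin i).
- have -> : ext3 G u ^~ w = fun v => ext3 (fun i a b c => G i b a c) v u w.
    by apply/funext => v; rewrite ext3_swap12.
  by apply: ext3_tlinear_1 => i b c; case: (Glin i).
have -> : ext3 G u v = fun w => ext3 (fun i a b c => G i b c a) w u v.
  by apply/funext => w; rewrite ext3_swap23 ext3_swap12.
by apply: ext3_tlinear_1 => i b c; case: (Glin i).
Qed.

Lemma ext1_cst (Phi : nat -> T -> T) a n :
  (forall i, linear (Phi i)) -> ext1 Phi (cst a) n = Phi n a.
Proof.
move=> Plin; have P0 i : Phi i 0 = 0 by exact: lin0 (Plin i).
rewrite /ext1 big_ord_recr /= [X in X + _]big1 ?add0r; last first.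
  by move=> [i Hi] _; apply: big1 => -[[|p] Hp] /= H; [lia|exact: P0].
rewrite big_mkcond big_ord_recl /= addn0 eqxx big1 ?addr0 //.
by move=> p _; case: ifP => // _; exact: P0.
Qed.

Lemma ext2_coef0 (F : nat -> T -> T -> T) u v :
  ext2 F u v 0%N = F 0%N (u 0%N) (v 0%N).
Proof. by rewrite /ext2 !big_ord1 big_ord1_cond. Qed.

Lemma ext3_coef0 (G : nat -> T -> T -> T -> T) u v w :
  ext3 G u v w 0%N = G 0%N (u 0%N) (v 0%N) (w 0%N).
Proof. by rewrite /ext3 !big_ord1 big_ord1_cond. Qed.

Lemma null2_bilinear (f : T -> T -> T) :
  is_bilinear f -> forall i, is_bilinear (null2 f i).
Proof.
move=> fb [|i]; first exact: fb.
by split=> ? ? ? ?; rewrite /null2 /= scaler0 addr0.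
Qed.

Lemma null3_trilinear (g : T -> T -> T -> T) :
  is_trilinear g -> forall i, is_trilinear (null3 g i).
Proof.
move=> gt [|i]; first exact: gt.
by split=> ? ? ? ? ?; rewrite /null3 /= scaler0 addr0.
Qed.

Lemma ext2_null (f : T -> T -> T) a b : is_bilinear f ->
  ext2 (null2 f) (cst a) (cst b) = cst (f a b).
Proof.
move=> [fl fr]; apply/funext => -[|n]; first exact: ext2_coef0.
apply: big1 => -[i Hi] _; apply: big1 => -[p Hp] _; apply: big1 => -[q Hq] /= H.
rewrite /null2 /cst; case: i p q {Hi Hp Hq} H => [|i] [|p] [|q] //= _;
  by rewrite ?(lin0 (fl _)) ?(lin0 (fr _)).
Qed.

Lemma ext3_null (g : T -> T -> T -> T) a b c : is_trilinear g ->
  ext3 (null3 g) (cst a) (cst b) (cst c) = cst (g a b c).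
Proof.
move=> [g1 g2 g3]; apply/funext => -[|n]; first exact: ext3_coef0.
apply: big1 => -[i Hi] _; apply: big1 => -[p Hp] _; apply: big1 => -[q Hq] _.
apply: big1 => -[r Hr] /= H.
rewrite /null3 /cst; case: i p q r {Hi Hp Hq Hr} H => [|i] [|p] [|q] [|r] //= _;
  by rewrite ?(lin0 (g1 _ _)) ?(lin0 (g2 _ _)) ?(lin0 (g3 _ _)).
Qed.

Lemma null_deformation (f : T -> T -> T) (g : T -> T -> T -> T) :
  is_LYA f g -> is_deformation f g (null2 f) (null3 g).
Proof.
case=> fb gt h1 h2 h3 h4 h5 h6.
have f2 := ext2_null _ _ fb; have g3 := ext3_null _ _ _ gt.
split=> /=; [exact: null2_bilinear|exact: null3_trilinear|by []|by []|..].
- by move=> a n; rewrite f2 h1 cst0.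
- by move=> a b n; rewrite g3 h2 cst0.
- by move=> a b c [|n]; rewrite !f2 !g3 /cst /= ?h3 ?addr0.
- by move=> a b c d [|n]; rewrite !f2 !g3 /cst /= ?h4 ?addr0.
- by move=> a b c d n; rewrite !(f2, g3) h5 cstD.
- by move=> a b c d e n; rewrite !g3 h6 !cstD.
Qed.

(** * The Lie-Yamaguti algebra of series *)

Section DeformedOperations.
Variables (ft : ser -> ser -> ser) (gt : ser -> ser -> ser -> ser).
Hypotheses (ftP : tbilinear ft) (gtP : ttrilinear gt).

(* Proves the t-linearity of expressions in ft and gt. *)
Ltac tlin := repeat first
  [ exact: tlinear_id | exact: tlinear0 | apply: tlinearD | apply: tlinearN
  | apply: (tbilinear_l ftP) | apply: (tbilinear_r ftP)
  | apply: (ttrilinear_1 gtP) | apply: (ttrilinear_2 gtP)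
  | apply: (ttrilinear_3 gtP) ].

(* Reduces an equality that is t-linear in u to the case of a constant u. *)
Ltac extend u :=
  match goal with |- ?L = ?R =>
    let L' := eval pattern u in L in let R' := eval pattern u in R in
    match L' with ?A _ => match R' with ?B _ =>
      apply: (@tlinear_ext A B _ _ _ u); [tlin | tlin | move=> {}u]
    end end
  end.

(** Identities (1)-(6) hold for all series if they hold for constants. *)
Lemma LYA_of_cst :
  (forall a, ft (cst a) (cst a) = 0) ->
  (forall a b, gt (cst a) (cst a) (cst b) = 0) ->
  (forall a b c, gt (cst a) (cst b) (cst c) + gt (cst b) (cst c) (cst a)
      + gt (cst c) (cst a) (cst b)
      + ft (ft (cst a) (cst b)) (cst c) + ft (ft (cst b) (cst c)) (cst a)
      + ft (ft (cst c) (cst a)) (cst b) = 0) ->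
  (forall a b c d, gt (ft (cst a) (cst b)) (cst c) (cst d)
      + gt (ft (cst b) (cst c)) (cst a) (cst d)
      + gt (ft (cst c) (cst a)) (cst b) (cst d) = 0) ->
  (forall a b c d, gt (cst a) (cst b) (ft (cst c) (cst d)) =
      ft (gt (cst a) (cst b) (cst c)) (cst d)
      + ft (cst c) (gt (cst a) (cst b) (cst d))) ->
  (forall a b c d e, gt (cst a) (cst b) (gt (cst c) (cst d) (cst e)) =
      gt (gt (cst a) (cst b) (cst c)) (cst d) (cst e)
      + gt (cst c) (gt (cst a) (cst b) (cst d)) (cst e)
      + gt (cst c) (cst d) (gt (cst a) (cst b) (cst e))) ->
  @is_LYA k ser ft gt.
Proof.
move=> h1 h2 h3 h4 h5 h6.
have [g1 g2 g3] := gtP.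
split.
- by split=> u; [exact: (ftP.1 u).1|exact: (ftP.2 u).1].
- by split=> u v; [exact: (g1 u v).1|exact: (g2 u v).1|exact: (g3 u v).1].
- exact: tbilinear_alternate.
- move=> u v; extend v.
  by apply: (@tbilinear_alternate (fun u u' => gt u u' _)) => //;
    split=> ?; tlin.
- by move=> u v w; extend u; extend v; extend w.
- by move=> u v w x; extend u; extend v; extend w; extend x.
- by move=> u v w x; extend u; extend v; extend w; extend x.
- by move=> u v w x y; extend u; extend v; extend w; extend x; extend y.
Qed.
End DeformedOperations.

Lemma deformation_LYA f g F G :
  is_deformation f g F G -> @is_LYA k ser (ext2 F) (ext3 G).
Proof.
move=> [Fb Gt _ _ h1 h2 h3 h4 h5 h6].
apply: LYA_of_cst; [exact: ext2_tbilinear|exact: ext3_ttrilinear|..] => *;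
  apply/funext; [exact: h1|exact: h2|exact: h3|exact: h4|exact: h5|exact: h6].
Qed.

Section Antisymmetry.
Variables (f : T -> T -> T) (g : T -> T -> T -> T).
Hypothesis fgLYA : is_LYA f g.

Lemma LYA_anti a b : f a b = - f b a.
Proof.
have [fl fr] := LYA_bilinear fgLYA.
have := LYA1 fgLYA (a + b).
rewrite (linD (fl _)) !(linD (fr _)) !(LYA1 fgLYA) add0r addr0.
by move/eqP; rewrite addr_eq0 => /eqP.
Qed.

Lemma LYA_anti3 a b c : g a b c = - g b a c.
Proof.
have [g1 g2 g3] := LYA_trilinear fgLYA.
have := LYA2 fgLYA (a + b) c.
rewrite (linD (g1 _ _)) !(linD (g2 _ _)) !(LYA2 fgLYA) add0r addr0.
by move/eqP; rewrite addr_eq0 => /eqP.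
Qed.
End Antisymmetry.

Lemma formal_iso_tlinear (Phi : nat -> T -> T) :
  is_formal_iso Phi -> tlinear (ext1 Phi).
Proof. by case=> _; exact: ext1_tlinear. Qed.

Lemma formal_iso_coef0 (Phi : nat -> T -> T) u :
  is_formal_iso Phi -> ext1 Phi u 0%N = u 0%N.
Proof.
by move=> [P0 Plin]; rewrite (tlinear_coef0 _ (ext1_tlinear Plin)) ext1_cst.
Qed.

(** * Inverses of t-linear maps with identity constant term *)

(** Every t-linear map is a series of linear maps. *)
Lemma tlinear_ext1 (A : ser -> ser) : tlinear A ->
  A = ext1 (fun i a => A (cst a) i).
Proof.
move=> At; have lin i : linear (fun a => A (cst a) i).
  by move=> c a b; rewrite cst_linear At.1 !coefE.
apply/funext; apply: tlinear_ext => // [|a]; first exact: ext1_tlinear.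
by apply/funext => n; rewrite ext1_cst.
Qed.

Section Inverse.
Variable P : ser -> ser.
Hypotheses (Pt : tlinear P) (P0 : forall u, P u 0%N = u 0%N).

Lemma tlinear_unit_coef n u : (forall i, (i < n)%N -> u i = 0) -> P u n = u n.
Proof. by move=> u0; rewrite (tlinear_order Pt u0).2 P0. Qed.

Lemma tlinear_unit_inj : injective P.
Proof.
move=> u v Puv; apply/eqP; rewrite -subr_eq0; apply/eqP/funext => n.
elim/ltn_ind: n => n IHn.
by rewrite -(tlinear_unit_coef IHn) (linB Pt.1) Puv subrr.
Qed.

(* The inverse of P = 1 - M is the sum of the M^j. As t^j divides M^j v, its
   coefficient of t^n is that of the partial sum S n below. *)
Let M u := u - P u.

Let M_iter_order u m : forall i, (i < m)%N -> iter m M u i = 0.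
Proof.
elim: m => [|m IHm] // i; rewrite ltnS leq_eqVlt => /orP [/eqP ->|im].
  by rewrite /= /M coefD coefN tlinear_unit_coef ?subrr.
by rewrite /= /M coefD coefN (tlinear_order Pt IHm).1 // IHm // subrr.
Qed.

Lemma tlinear_unit_surj v : exists u, P u = v.
Proof.
pose S n : ser := \sum_(j < n.+1) iter j M v.
have S_rec n : S n.+1 = S n + iter n.+1 M v by rewrite /S big_ord_recr.
have PS n : P (S n) = v - iter n.+1 M v.
  elim: n => [|n IHn]; first by rewrite /S big_ord1 /= /M subKr.
  rewrite S_rec (linD Pt.1) IHn.
  have -> : iter n.+2 M v = iter n.+1 M v - P (iter n.+1 M v) by [].
  abelian.
have Sstable n i : (i <= n)%N -> S n i = S i i.
  elim: n => [|n IHn]; first by rewrite leqn0 => /eqP ->.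
  rewrite leq_eqVlt => /orP [/eqP -> //|ilen].
  by rewrite S_rec coefD (M_iter_order v ilen) addr0 IHn.
exists (fun n => S n n); apply/funext => n.
pose d : ser := (fun n => S n n) - S n.
have d0 i : (i <= n)%N -> d i = 0.
  by move=> ilen; rewrite /d !coefE Sstable ?subrr.
have -> : (fun n => S n n) = S n + d :> ser by rewrite /d addrC subrK.
rewrite (linD Pt.1) coefD PS coefD coefN M_iter_order // subr0.
by rewrite (tlinear_order (n := n.+1) Pt d0).1 ?addr0.
Qed.

Lemma tlinear_unit_inverse : exists Q,
  [/\ tlinear Q, forall u, Q (P u) = u & forall u, P (Q u) = u].
Proof.
have [Q PQ] := choice tlinear_unit_surj.
have QP u : Q (P u) = u by apply: tlinear_unit_inj; rewrite PQ.
exists Q; split=> //; split=> [c u v|u]; apply: tlinear_unit_inj.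
  by rewrite Pt.1 !PQ.
by rewrite Pt.2 !PQ.
Qed.
End Inverse.

End Series.

(** * Defects *)

(** The extensions to series of the operations are written ft and gt for those
    of the deformation, f0 and g0 for the original ones. *)
Section Rigidity.
Variables (k : fieldType) (T : lmodType k).
Local Notation ser := (nat -> T).
Implicit Types (u v w : ser) (P : ser -> ser).
Variables (f : T -> T -> T) (g : T -> T -> T -> T).
Variables (F : nat -> T -> T -> T) (G : nat -> T -> T -> T -> T).
Hypotheses (fgLYA : is_LYA f g) (FGdef : is_deformation f g F G).

Local Notation ft := (ext2 F).
Local Notation gt := (ext3 G).
Local Notation f0 := (ext2 (null2 f)).
Local Notation g0 := (ext3 (null3 g)).

Let ftP : tbilinear ft := ext2_tbilinear (def_bilinear FGdef).
Let gtP : ttrilinear gt := ext3_ttrilinear (def_trilinear FGdef).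
Let f0P : tbilinear f0 := ext2_tbilinear (null2_bilinear (LYA_bilinear fgLYA)).
Let g0P : ttrilinear g0 :=
  ext3_ttrilinear (null3_trilinear (LYA_trilinear fgLYA)).
Let ftLYA : @is_LYA k ser ft gt := deformation_LYA FGdef.
Let f0LYA : @is_LYA k ser f0 g0 := deformation_LYA (null_deformation fgLYA).

(** The defects measure how far P is from being a morphism from the deformed
    operations to the original ones, extended to series. *)
Definition defect2 P u v : ser := P (ft u v) - f0 (P u) (P v).
Definition defect3 P u v w : ser := P (gt u v w) - g0 (P u) (P v) (P w).

Lemma defect2_tbilinear P : tlinear P -> tbilinear (defect2 P).
Proof.
move=> Pt; split=> u; apply: tlinearD.
- exact: (tlinear_comp Pt (ftP.1 u)).
- by apply: tlinearN; exact: (tlinear_comp (f0P.1 _) Pt).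
- exact: (tlinear_comp Pt (ftP.2 u)).
- by apply: tlinearN; exact: (tlinear_comp (f0P.2 _) Pt).
Qed.

Lemma defect3_ttrilinear P : tlinear P -> ttrilinear (defect3 P).
Proof.
have [t1 t2 t3] := gtP; have [n1 n2 n3] := g0P.
move=> Pt; split=> u v; apply: tlinearD.
- exact: (tlinear_comp Pt (t1 u v)).
- by apply: tlinearN; exact: (tlinear_comp (n1 _ _) Pt).
- exact: (tlinear_comp Pt (t2 u v)).
- by apply: tlinearN; exact: (tlinear_comp (n2 _ _) Pt).
- exact: (tlinear_comp Pt (t3 u v)).
- by apply: tlinearN; exact: (tlinear_comp (n3 _ _) Pt).
Qed.

(** If t^n divides an argument of f0 or g0, then the coefficient of t^n only
    involves the leading coefficient of this argument and the constant terms of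
    the other ones. *)
Lemma f0_order_l n d v : (forall i, (i < n)%N -> d i = 0) ->
  f0 d v n = f (d n) (v 0%N).
Proof.
by move=> d0; rewrite (tlinear_order (f0P.1 v) d0).2 ext2_coef0.
Qed.

Lemma f0_order_r n d u : (forall i, (i < n)%N -> d i = 0) ->
  f0 u d n = f (u 0%N) (d n).
Proof.
by move=> d0; rewrite (tlinear_order (f0P.2 u) d0).2 ext2_coef0.
Qed.

Lemma g0_order_1 n d v w : (forall i, (i < n)%N -> d i = 0) ->
  g0 d v w n = g (d n) (v 0%N) (w 0%N).
Proof.
case: g0P => h _ _ d0.
by rewrite (tlinear_order (h v w) d0).2 ext3_coef0.
Qed.

Lemma g0_order_2 n d u w : (forall i, (i < n)%N -> d i = 0) ->
  g0 u d w n = g (u 0%N) (d n) (w 0%N).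
Proof.
case: g0P => _ h _ d0.
by rewrite (tlinear_order (h u w) d0).2 ext3_coef0.
Qed.

Lemma g0_order_3 n d u v : (forall i, (i < n)%N -> d i = 0) ->
  g0 u v d n = g (u 0%N) (v 0%N) (d n).
Proof.
case: g0P => _ _ h d0.
by rewrite (tlinear_order (h u v) d0).2 ext3_coef0.
Qed.

Let f0Dl u u' v : f0 (u + u') v = f0 u v + f0 u' v.
Proof. exact: linD (f0P.1 v).1 u u'. Qed.
Let f0Dr u v v' : f0 u (v + v') = f0 u v + f0 u v'.
Proof. exact: linD (f0P.2 u).1 v v'. Qed.
Let f0D := (f0Dl, f0Dr).

Let g0D1 u u' v w : g0 (u + u') v w = g0 u v w + g0 u' v w.
Proof. by case: g0P => h _ _; exact: linD (h v w).1 u u'. Qed.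
Let g0D2 u v v' w : g0 u (v + v') w = g0 u v w + g0 u v' w.
Proof. by case: g0P => _ h _; exact: linD (h u w).1 v v'. Qed.
Let g0D3 u v w w' : g0 u v (w + w') = g0 u v w + g0 u v w'.
Proof. by case: g0P => _ _ h; exact: linD (h u v).1 w w'. Qed.
Let g0D := (g0D1, g0D2, g0D3).

(** * The leading coefficients of the defects form a cocycle *)

Section Cocycle.
Variables (P : ser -> ser) (n : nat).
Hypotheses (Pt : tlinear P) (P0 : forall u, P u 0%N = u 0%N).
Local Notation E := (defect2 P).
Local Notation H := (defect3 P).
Hypothesis E_lt : forall a b i, (i < n)%N -> E (cst a) (cst b) i = 0.
Hypothesis H_lt : forall a b c i, (i < n)%N -> H (cst a) (cst b) (cst c) i = 0.

Let En a b := E (cst a) (cst b) n.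
Let Hn a b c := H (cst a) (cst b) (cst c) n.

Lemma defect2_lt u v i : (i < n)%N -> E u v i = 0.
Proof.
have [E1 E2] := defect2_tbilinear Pt.
apply: (tlinear_vanish (E2 u)) => b {}i.
apply: (tlinear_vanish (E1 _)) => a {}i.
exact: E_lt.
Qed.

Lemma defect2_lead u v : E u v n = En (u 0%N) (v 0%N).
Proof.
have [E1 E2] := defect2_tbilinear Pt.
rewrite (tlinear_lead (E2 u)) => [|b i]; last exact: defect2_lt.
by apply: (tlinear_lead (E1 _)) => a i; exact: defect2_lt.
Qed.

Lemma defect3_lt u v w i : (i < n)%N -> H u v w i = 0.
Proof.
have [H1 H2 H3] := defect3_ttrilinear Pt.
apply: (tlinear_vanish (H3 u v)) => c {}i.
apply: (tlinear_vanish (H2 u _)) => b {}i.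
by apply: (tlinear_vanish (H1 _ _)) => a {}i; exact: H_lt.
Qed.

Lemma defect3_lead u v w : H u v w n = Hn (u 0%N) (v 0%N) (w 0%N).
Proof.
have [H1 H2 H3] := defect3_ttrilinear Pt.
rewrite (tlinear_lead (H3 u v)) => [|c i]; last exact: defect3_lt.
rewrite (tlinear_lead (H2 u _)) => [|b i]; last exact: defect3_lt.
by apply: (tlinear_lead (H1 _ _)) => a i; exact: defect3_lt.
Qed.

Let PE u v : P (ft u v) = E u v + f0 (P u) (P v).
Proof. by rewrite /defect2 subrK. Qed.
Let PH u v w : P (gt u v w) = H u v w + g0 (P u) (P v) (P w).
Proof. by rewrite /defect3 subrK. Qed.

Lemma En_C2 : C2 En.
Proof.
have [E1 E2] := defect2_tbilinear Pt.
split; last first.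
  move=> a; rewrite /En /defect2 (LYA1 ftLYA) (LYA1 f0LYA) subr0.
  by rewrite (lin0 Pt.1).
by split=> a c x y; rewrite /En cst_linear ?(E1 _).1 ?(E2 _).1 !coefE.
Qed.

Lemma Hn_C3 : C3 Hn.
Proof.
have [E1 E2 E3] := defect3_ttrilinear Pt.
split; last first.
  move=> a b; rewrite /Hn /defect3 (LYA2 ftLYA) (LYA2 f0LYA) subr0.
  by rewrite (lin0 Pt.1).
by split=> a b c x y; rewrite /Hn cst_linear ?(E1 _ _).1 ?(E2 _ _).1 ?(E3 _ _).1
  !coefE.
Qed.

Let ft0 u v : ft u v 0%N = f (u 0%N) (v 0%N).
Proof. by rewrite ext2_coef0 (def_F0 FGdef). Qed.
Let gt0 u v w : gt u v w 0%N = g (u 0%N) (v 0%N) (w 0%N).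
Proof. by rewrite ext3_coef0 (def_G0 FGdef). Qed.

(* Coefficients of t^n of the terms in which a defect, divisible by t^n, is an
   argument of an original operation. *)
Let f0_E_l u v w : f0 (E u v) (P w) n = f (En (u 0%N) (v 0%N)) (w 0%N).
Proof. by rewrite f0_order_l ?defect2_lead ?P0 // => i; exact: defect2_lt. Qed.
Let f0_H_l u v w x :
  f0 (H u v w) (P x) n = f (Hn (u 0%N) (v 0%N) (w 0%N)) (x 0%N).
Proof. by rewrite f0_order_l ?defect3_lead ?P0 // => i; exact: defect3_lt. Qed.
Let f0_H_r u v w x :
  f0 (P x) (H u v w) n = f (x 0%N) (Hn (u 0%N) (v 0%N) (w 0%N)).
Proof. by rewrite f0_order_r ?defect3_lead ?P0 // => i; exact: defect3_lt. Qed.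
Let g0_E_1 u v w x :
  g0 (E u v) (P w) (P x) n = g (En (u 0%N) (v 0%N)) (w 0%N) (x 0%N).
Proof. by rewrite g0_order_1 ?defect2_lead ?P0 // => i; exact: defect2_lt. Qed.
Let g0_E_3 u v w x :
  g0 (P w) (P x) (E u v) n = g (w 0%N) (x 0%N) (En (u 0%N) (v 0%N)).
Proof. by rewrite g0_order_3 ?defect2_lead ?P0 // => i; exact: defect2_lt. Qed.
Let g0_H_1 u v w x y : g0 (H u v w) (P x) (P y) n =
  g (Hn (u 0%N) (v 0%N) (w 0%N)) (x 0%N) (y 0%N).
Proof. by rewrite g0_order_1 ?defect3_lead ?P0 // => i; exact: defect3_lt. Qed.
Let g0_H_2 u v w x y : g0 (P x) (H u v w) (P y) n =
  g (x 0%N) (Hn (u 0%N) (v 0%N) (w 0%N)) (y 0%N).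
Proof. by rewrite g0_order_2 ?defect3_lead ?P0 // => i; exact: defect3_lt. Qed.
Let g0_H_3 u v w x y : g0 (P x) (P y) (H u v w) n =
  g (x 0%N) (y 0%N) (Hn (u 0%N) (v 0%N) (w 0%N)).
Proof. by rewrite g0_order_3 ?defect3_lead ?P0 // => i; exact: defect3_lt. Qed.

Let leadE := (f0_E_l, f0_H_l, f0_H_r, g0_E_1, g0_E_3, g0_H_1, g0_H_2, g0_H_3,
  defect2_lead, defect3_lead, ft0, gt0).

Let cst_coef0 a : cst a 0%N = a :> T. Proof. by []. Qed.

Lemma defect_cocycle : in_Z2Z3 f g En Hn.
Proof.
(* The defects are made opaque, lest their subtractions be expanded. *)
split; [exact: En_C2|exact: Hn_C3|..]; move: (PE) (PH) (leadE);
  move: (defect2 P) (defect3 P) => E' H' PE' PH' leadE'.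
- move=> x1 x2 x3 x4; rewrite /delta_I /rho /D.
  have := congr1 P (LYA5 ftLYA (cst x1) (cst x2) (cst x3) (cst x4)).
  rewrite (linD Pt.1) !(PE', PH') !(f0D, g0D) (LYA5 f0LYA).
  move/(congr1 (@^~ n)); rewrite !coefE !leadE' !cst_coef0 => h.
  apply: (eq_by_diff h); rewrite (LYA_anti fgLYA x4 (Hn _ _ _)).
  abelian.
- move=> x1 x2 x3 x4 x5; rewrite /delta_II /theta /D.
  have := congr1 P (LYA6 ftLYA (cst x1) (cst x2) (cst x3) (cst x4) (cst x5)).
  rewrite !(linD Pt.1) !(PE', PH') !(f0D, g0D) (LYA6 f0LYA).
  move/(congr1 (@^~ n)); rewrite !coefE !leadE' !cst_coef0 => h.
  apply: (eq_by_diff h); rewrite (LYA_anti3 fgLYA x3 (Hn _ _ _)).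
  abelian.
- move=> a b c; rewrite /deltastar_I /rho.
  have := congr1 P (LYA3 ftLYA (cst a) (cst b) (cst c)).
  rewrite !(linD Pt.1) (lin0 Pt.1) !(PE', PH') !(f0D, g0D).
  rewrite -[RHS](LYA3 f0LYA (P (cst a)) (P (cst b)) (P (cst c))).
  move/(congr1 (@^~ n)); rewrite !coefE !leadE' !cst_coef0 => h.
  apply: (eq_by_diff h).
  rewrite (LYA_anti fgLYA a (En _ _)) (LYA_anti fgLYA b (En _ _))
    (LYA_anti fgLYA c (En _ _)).
  abelian.
- move=> a b c d; rewrite /deltastar_II /theta.
  have := congr1 P (LYA4 ftLYA (cst a) (cst b) (cst c) (cst d)).
  rewrite !(linD Pt.1) (lin0 Pt.1) !(PE', PH') !(f0D, g0D).
  rewrite -[RHS](LYA4 f0LYA (P (cst a)) (P (cst b)) (P (cst c)) (P (cst d))).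
  move/(congr1 (@^~ n)); rewrite !coefE !leadE' !cst_coef0 => h.
  apply: (eq_by_diff h).
  abelian.
Qed.
End Cocycle.

(** * Killing the defects *)

(** When two formal isomorphisms agree modulo t^m, the coefficients of t^m in
    their defects differ by the coboundary of the difference chi of the m-th
    coefficients. *)
Section ChangeOfCoefficient.
Variables (Phi Phi' : nat -> T -> T) (m : nat).
Hypotheses (Phi_iso : is_formal_iso Phi) (Phi'_iso : is_formal_iso Phi').
Hypothesis agree : forall i, (i < m)%N -> Phi' i = Phi i.

Let d u : ser := ext1 Phi' u - ext1 Phi u.
Let chi a := Phi' m a - Phi m a.

Let dt : tlinear d.
Proof. by apply: tlinearD; [|apply: tlinearN]; exact: formal_iso_tlinear. Qed.

Let d_cst a i : d (cst a) i = Phi' i a - Phi i a.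
Proof.
by rewrite /d !coefE !ext1_cst; [|exact: Phi_iso.2|exact: Phi'_iso.2].
Qed.

Let d_lt u i : (i < m)%N -> d u i = 0.
Proof.
by apply: (tlinear_vanish dt) => a {}i im; rewrite d_cst agree ?subrr.
Qed.

Let d_lead u : d u m = chi (u 0%N).
Proof. by rewrite (tlinear_lead dt) ?d_cst // => a i; exact: d_lt. Qed.

Let dE u : ext1 Phi' u = ext1 Phi u + d u.
Proof. by rewrite addrC subrK. Qed.

Lemma defect2_change a b :
  defect2 (ext1 Phi') (cst a) (cst b) m =
  defect2 (ext1 Phi) (cst a) (cst b) m - delta1_I f chi a b.
Proof.
have f0_change : f0 (ext1 Phi' (cst a)) (ext1 Phi' (cst b)) m =
    f0 (ext1 Phi (cst a)) (ext1 Phi (cst b)) m + f a (chi b) + f (chi a) b.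
  rewrite {1}(dE (cst a)) f0Dl {1}(dE (cst b)) f0Dr !coefD.
  rewrite (@f0_order_r m (d _)) => [|? ?]; last exact: d_lt.
  rewrite (@f0_order_l m (d _)) => [|? ?]; last exact: d_lt.
  by rewrite !d_lead !formal_iso_coef0.
rewrite /defect2 /delta1_I /rho !coefE f0_change (dE (ft _ _)) coefD d_lead.
rewrite ext2_coef0 (def_F0 FGdef) /cst /= (LYA_anti fgLYA (chi a)).
abelian.
Qed.

Lemma defect3_change a b c :
  defect3 (ext1 Phi') (cst a) (cst b) (cst c) m =
  defect3 (ext1 Phi) (cst a) (cst b) (cst c) m - delta1_II g chi a b c.
Proof.
have g0_change :
    g0 (ext1 Phi' (cst a)) (ext1 Phi' (cst b)) (ext1 Phi' (cst c)) m =
    g0 (ext1 Phi (cst a)) (ext1 Phi (cst b)) (ext1 Phi (cst c)) m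
    + g a b (chi c) + g a (chi b) c + g (chi a) b c.
  rewrite {1}(dE (cst a)) g0D1 {1}(dE (cst b)) g0D2 {1}(dE (cst c)) g0D3 !coefD.
  rewrite (@g0_order_3 m (d _)) => [|? ?]; last exact: d_lt.
  rewrite (@g0_order_2 m (d _)) => [|? ?]; last exact: d_lt.
  rewrite (@g0_order_1 m (d _)) => [|? ?]; last exact: d_lt.
  by rewrite !d_lead !formal_iso_coef0.
rewrite /defect3 /delta1_II /theta /D !coefE g0_change (dE (gt _ _ _)) coefD.
rewrite d_lead.
rewrite ext3_coef0 (def_G0 FGdef) /cst /= (LYA_anti3 fgLYA a (chi b)).
abelian.
Qed.
End ChangeOfCoefficient.

(** Phi has no defect modulo t^n. *)
Definition trivializes (n : nat) (Phi : nat -> T -> T) : Prop :=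
  [/\ is_formal_iso Phi,
      forall a b i, (i < n)%N -> defect2 (ext1 Phi) (cst a) (cst b) i = 0 &
      forall a b c i, (i < n)%N ->
        defect3 (ext1 Phi) (cst a) (cst b) (cst c) i = 0].

Lemma delta1_I_0 a b : delta1_I f (fun=> 0) a b = 0.
Proof.
have [fl fr] := LYA_bilinear fgLYA.
by rewrite /delta1_I /rho (lin0 (fr _)) (lin0 (fr _)) !subr0.
Qed.

Lemma delta1_II_0 a b c : delta1_II g (fun=> 0) a b c = 0.
Proof.
have [g1 g2 g3] := LYA_trilinear fgLYA.
rewrite /delta1_II /theta /D (lin0 (g1 _ _)) (lin0 (g1 _ _)) (lin0 (g3 _ _)).
by rewrite addr0 !subr0.
Qed.

Lemma trivializes_agree n (Phi Phi' : nat -> T -> T) :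
  is_formal_iso Phi' -> (forall i, (i < n)%N -> Phi' i = Phi i) ->
  trivializes n Phi -> trivializes n Phi'.
Proof.
move=> iso' agree [iso E0 H0].
have chi0 i : (i < n)%N -> (fun a => Phi' i a - Phi i a) = fun=> 0.
  by move=> lin; apply/funext => a; rewrite agree ?subrr.
split=> // [a b|a b c] i lin.
  rewrite (@defect2_change Phi Phi') //.
    by rewrite E0 // chi0 // delta1_I_0 subr0.
  by move=> j ji; apply: agree; exact: ltn_trans lin.
rewrite (@defect3_change Phi Phi') //.
  by rewrite H0 // chi0 // delta1_II_0 subr0.
by move=> j ji; apply: agree; exact: ltn_trans lin.
Qed.

Hypothesis H2H3 : H2H3_eq0 f g.

Lemma trivializes_step n (Phi : nat -> T -> T) : trivializes n.+1 Phi ->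
  exists Phi', trivializes n.+2 Phi' /\ forall i, (i <= n)%N -> Phi' i = Phi i.
Proof.
move=> tPhi; have [iso E0 H0] := tPhi; have [Phi0 Plin] := iso.
have coc := defect_cocycle (formal_iso_tlinear iso)
  (fun u => formal_iso_coef0 u iso) E0 H0.
have [phi [phi_lin Ephi Hphi]] := H2H3 coc.
pose Phi' i := if i == n.+1 then (fun a => Phi i a + phi a) else Phi i.
have agree i : (i < n.+1)%N -> Phi' i = Phi i.
  by move=> lin; rewrite /Phi' (ltn_eqF lin).
have iso' : is_formal_iso Phi'.
  split=> [a|i]; first by rewrite agree.
  rewrite /Phi'; case: eqP => _; last exact: Plin.
  by move=> c a b; rewrite Plin phi_lin scalerDr addrACA.
have chiE : (fun a => Phi' n.+1 a - Phi n.+1 a) = phi.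
  by apply/funext => a; rewrite /Phi' eqxx addrC addKr.
have [_ E0' H0'] := trivializes_agree iso' agree tPhi.
exists Phi'; split=> //; split=> // [a b|a b c] i;
    rewrite ltnS leq_eqVlt => /orP [/eqP ->|].
- by rewrite (@defect2_change Phi Phi') // chiE -Ephi subr0 subrr.
- exact: E0'.
- by rewrite (@defect3_change Phi Phi') // chiE -Hphi subr0 subrr.
- exact: H0'.
Qed.

Lemma trivializes_start : trivializes 1 (fun i a => if i == 0%N then a else 0).
Proof.
set Phi := fun _ => _.
have iso : is_formal_iso Phi.
  split=> // -[|i] c a b //; by rewrite /Phi /= scaler0 addr0.
split=> // [a b|a b c] [|//] _.
  rewrite /defect2 !coefE formal_iso_coef0 // !ext2_coef0 !formal_iso_coef0 //.
  by rewrite (def_F0 FGdef) subrr.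
rewrite /defect3 !coefE formal_iso_coef0 // !ext3_coef0 !formal_iso_coef0 //.
by rewrite (def_G0 FGdef) subrr.
Qed.

Lemma exists_trivializing : exists Phi, forall n, trivializes n Phi.
Proof.
have step (x : nat * (nat -> T -> T)) : exists Phi', trivializes x.1.+1 x.2 ->
    trivializes x.1.+2 Phi' /\ forall i, (i <= x.1)%N -> Phi' i = x.2 i.
  have [/trivializes_step [Phi' ?]|?] := pselect (trivializes x.1.+1 x.2).
    by exists Phi'.
  by exists x.2.
have [next nextP] := choice step.
(* stage n is the approximation of degree n; its coefficients up to n are
   final, so that the diagonal is the limit. *)
pose fix stage n := if n is m.+1 then next (m, stage m)
                    else fun i a => if i == 0%N then a else 0.
have stage_triv n : trivializes n.+1 (stage n).
  elim: n => [|n IHn] /=; first exact: trivializes_start.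
  exact: (nextP (n, stage n) IHn).1.
have stage_agree i j : (i <= j)%N -> stage j i = stage i i.
  elim: j => [|j IHj]; first by rewrite leqn0 => /eqP ->.
  rewrite leq_eqVlt => /orP [/eqP -> //|ij].
  by rewrite -(IHj ij); exact: (nextP (j, stage j) (stage_triv j)).2.
have iso : is_formal_iso (fun i => stage i i).
  by split=> [a|i]; [case: (stage_triv 0%N) => -[]|case: (stage_triv i) => -[]].
exists (fun i => stage i i) => n.
have [_ E0 H0] : trivializes n.+1 (fun i => stage i i).
  by apply: trivializes_agree (stage_triv n) => // i ?; rewrite stage_agree.
by split=> // [a b|a b c] i lin; [apply: E0|apply: H0]; exact: ltnW.
Qed.

Lemma rigid_deformation :
  equivalent_deformations F G (null2 f) (null3 g).
Proof.
have [Phi tPhi] := exists_trivializing.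
have [iso _ _] := tPhi 0%N; have Pt := formal_iso_tlinear iso.
have [Q [Qt QP PQ]] :=
  tlinear_unit_inverse Pt (fun u => formal_iso_coef0 u iso).
exists Phi, (fun i a => Q (cst a) i); rewrite -(tlinear_ext1 Qt); split=> //.
- split=> [i c a b|u n|u n]; first by rewrite cst_linear Qt.1 !coefE.
  + by rewrite -(tlinear_ext1 Qt) QP.
  + by rewrite -(tlinear_ext1 Qt) PQ.
- move=> a b n.
  have E0 : defect2 (ext1 Phi) (cst a) (cst b) = 0.
    by apply/funext => i; case: (tPhi i.+1) => _ E0 _; exact: E0.
  by rewrite -[in RHS](subr0_eq E0) QP.
move=> a b c n.
have H0 : defect3 (ext1 Phi) (cst a) (cst b) (cst c) = 0.
  by apply/funext => i; case: (tPhi i.+1) => _ _ H0; exact: H0.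
by rewrite -[in RHS](subr0_eq H0) QP.
Qed.
End Rigidity.

Theorem theorem5p1 (k : fieldType) (T : lmodType k)
    (f : T -> T -> T) (g : T -> T -> T -> T)
    (char0 : [pchar k] =i pred0)
    (hT : is_LYA f g)
    (hH : H2H3_eq0 f g) :
  analytically_rigid f g.
Proof. by move=> F G FGdef; exact: rigid_deformation. Qed.
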